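(* For every positive integer $n$, $\nu(n-1)\equiv\widetilde{\sigma}_3(n)\pmod 3$.
   Context: The integers $\nu(n)$, $n\ge0$, are defined by $$\sum_{n=0}^\infty\nu(n)q^n=\prod_{n=1}^\infty(1-q^{2n})^8(1+q^n)^8.$$ For a positive integer $n$, $\widetilde{\sigma}_3(n)=\sum_{d\mid n}(-1)^{d-1}d^3$. *)

(* Defs.v *)
From HB Require Import structures.
From mathcomp Require Import all_boot all_order all_algebra.
From mathcomp Require Import ring.

Set Implicit Arguments.
Unset Strict Implicit.
Unset Printing Implicit Defensive.

Import Order.TTheory GRing.Theory Num.Theory.
Local Open Scope ring_scope.

(* A formal power series sum_n a_n q^n over int is encoded by its coefficient
   sequence a.  [infprod_series F a] says that the infinite product of the
   polynomials F 1, F 2, F 3, ... converges to that series in the q-adic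
   topology of Z[[q]]: each coefficient of the partial products is eventually
   constant, equal to that of the series. *)
Definition infprod_series (F : nat -> {poly int}) (a : nat -> int) : Prop :=
  forall n : nat, exists M : nat, forall N : nat, (M <= N)%N ->
    (\prod_(1 <= m < N.+1) F m)`_n = a n.

Definition nu_factor (m : nat) : {poly int} :=
  (1 - 'X^(2 * m)) ^+ 8 * (1 + 'X^m) ^+ 8.

Definition is_nu (nu : nat -> int) : Prop := infprod_series nu_factor nu.

Definition sigma3_tilde (n : nat) : int :=
  \sum_(d <- divisors n) (-1) ^+ (d - 1)%N * (d%:Z) ^+ 3.

(* [is_nu] determines nu: the product converges, and its limit is unique. *)
Lemma nu_factorE (m : nat) :
  exists g : {poly int}, nu_factor m = 1 + 'X^m * g.
Proof.
pose y : {poly int} := (1 - 'X^(2 * m)) * (1 + 'X^m).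
exists ((1 - 'X^m - 'X^m ^+ 2) * \sum_(i < 8) y ^+ i).
have ->: nu_factor m = 1 + (y ^+ 8 - 1) by rewrite /nu_factor /y exprMn; ring.
rewrite subrX1 mulrA; congr (1 + _ * _).
by rewrite /y mulnC exprM; ring.
Qed.

Lemma is_nu_exists : exists nu : nat -> int, is_nu nu.
Proof.
exists (fun n => (\prod_(1 <= m < n.+1) nu_factor m)`_n) => n; exists n.
elim=> [|N IHN]; first by rewrite leqn0 => /eqP ->.
rewrite leq_eqVlt ltnS => /orP[/eqP -> //|le_nN].
have [g gE] := nu_factorE N.+1.
rewrite big_nat_recr //= gE mulrDr mulr1 coefD IHN //.
by rewrite mulrCA coefXnM ltnS le_nN addr0.
Qed.

Lemma is_nu_unique (nu1 nu2 : nat -> int) : is_nu nu1 -> is_nu nu2 -> nu1 =1 nu2.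
Proof.
move=> h1 h2 n; have [M1 e1] := h1 n; have [M2 e2] := h2 n.
by rewrite -(e1 _ (leq_maxl M1 M2)) e2 ?leq_maxr.
Qed.

(* Main.v *)
Require Import Defs.
From mathcomp Require Import all_boot all_order all_algebra all_field.
From mathcomp Require Import ring zify.

Set Implicit Arguments.
Unset Strict Implicit.
Unset Printing Implicit Defensive.

Import Order.TTheory GRing.Theory Num.Theory.
Local Open Scope ring_scope.

(** The eighth power in the product defining [nu] is that of
      Psi = prod_(m >= 1) (1 - q^(2m)) (1 + q^m),
    and the idea is to compute the logarithmic derivative of Psi modulo 3 in
    two ways.

    On the one hand, Euler's identity prod (1 + q^m) prod (1 - q^(2m-1)) = 1
    gives Psi = prod (1 - q^(2m)) / prod (1 - q^(2m-1)), so that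
      q Psi' / Psi = sum_n (sum_(d | n) (-1)^(d-1) d) q^n
    ([xderiv_psi], [log_xderiv_coef]).  On the other hand, Gauss's identity
    Psi = sum_k q^(k(k+1)/2) ([gauss_psi]) gives
    q Psi' = sum_k (k(k+1)/2) q^(k(k+1)/2).  Modulo 3 only the indices
    k = 3j+1 survive, with k(k+1)/2 = 9 (j(j+1)/2) + 1, hence
    q Psi' = q Psi(q^9) = q Psi^9 by Frobenius ([xderiv_psi_sum_char3]).
    Dividing by Psi,
      q Psi^8 = sum_n (sum_(d | n) (-1)^(d-1) d) q^n   over F_3,
    and d = d^3 in F_3.

    Gauss's identity is obtained from a finite identity of Shanks
    ([shanks_identity]), valid in any commutative ring.  Power series are
    replaced by polynomials over a field, compared modulo a power of 'X;
    the only division ever needed is the cancellation of a polynomial with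
    nonzero constant term. *)

(** * A finite form of Gauss's identity for triangular numbers *)

Section GaussFinite.
Variables (R : comNzRingType) (q : R).

Definition oddp n : R := \prod_(0 <= j < n) (1 - q ^+ (2 * j).+1).
Definition evenp s n : R := \prod_(s <= j < n) (1 - q ^+ (2 * j).+2).
Definition psi_sum n : R := \sum_(0 <= k < n) q ^+ 'C(k.+1, 2).

Lemma oddpS n : oddp n.+1 = oddp n * (1 - q ^+ (2 * n).+1).
Proof. by rewrite /oddp big_nat_recr. Qed.

Lemma psi_sumS n : psi_sum n.+1 = psi_sum n + q ^+ 'C(n.+1, 2).
Proof. by rewrite /psi_sum big_nat_recr. Qed.

(** The summand is the increment from [t] to [t.+1] of the right-hand side:
    with a = q^(2t) and b = q^(2n+1),
      (1 - a) + a (1 - q b) - (1 - b) = b (1 - q a),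
    where 1 - q a is the factor that [oddp t.+1] adds to [oddp t], and
    [evenp t n] = (1 - q^2 a) [evenp t.+1 n] supplies the last factor of the
    right-hand side at [t.+1]. *)
Lemma shanks_telescope n t : (t <= n)%N ->
  \sum_(0 <= s < t) oddp s * evenp s n * q ^+ (s * (2 * n).+1) *
     (q ^+ (2 * s) * (1 - q ^+ (2 * n).+2) - (1 - q ^+ (2 * n).+1))
  = oddp t * evenp t n * q ^+ (t * (2 * n).+1) * (1 - q ^+ (2 * t)).
Proof.
elim: t => [|t IHt] le_tn; first by rewrite big_nil muln0 expr0 subrr mulr0.
rewrite big_nat_recr //= IHt 1?ltnW // oddpS /evenp big_ltn // -/(evenp _ _).
have -> : (2 * t.+1 = (2 * t).+2)%N by lia.
rewrite (mulSn t) exprD !(exprS q (2 * _).+1) (exprS q (2 * t)).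
move: (q ^+ (2 * n).+1) (q ^+ (2 * t)) (q ^+ (t * _)) => b a c; ring.
Qed.

(** Divided by [oddp n], the right-hand side is
    sum_s (P_n / P_s) q^(s(2n+1)) with P_n the quotient of the product of
    the first n factors 1 - q^(2j+2) by that of the first n factors
    1 - q^(2j+1).  The term s = 0 is P_n and the others have order at
    least 2n+1, so in the limit this is Gauss's identity.  By the telescoping,
    passing from n to n+1 adds exactly two triangular powers. *)
Lemma shanks_identity n :
  psi_sum (2 * n) * oddp n =
  \sum_(0 <= s < n) oddp s * evenp s n * q ^+ (s * (2 * n).+1).
Proof.
elim: n => [|n IHn]; first by rewrite big_nil /psi_sum big_nil mul0r.
have -> : (2 * n.+1 = (2 * n).+2)%N by lia.
rewrite big_nat_recr //= !psi_sumS oddpS.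
have -> : 'C((2 * n).+1, 2) = (n * (2 * n).+1)%N by rewrite bin2 /=; lia.
have -> : 'C((2 * n).+2, 2) = (n * (2 * n).+1 + (2 * n).+1)%N.
  by rewrite bin2 /=; lia.
have e1 s : (s * (2 * n).+3 = s * (2 * n).+1 + 2 * s)%N by lia.
under eq_big_nat => s /andP[_ lt_sn].
  rewrite e1 exprD {1}/evenp big_nat_recr 1?ltnW //= -/(evenp s n).
  over.
have h := shanks_telescope (leqnn n).
rewrite {2}/evenp big_geq // mulr1 in h.
have e2 : \sum_(0 <= s < n) oddp s * (evenp s n * (1 - q ^+ (2 * n).+2)) *
      (q ^+ (s * (2 * n).+1) * q ^+ (2 * s)) =
   oddp n * q ^+ (n * (2 * n).+1) * (1 - q ^+ (2 * n)) +
   (1 - q ^+ (2 * n).+1) * (psi_sum (2 * n) * oddp n).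
  rewrite IHn -h mulr_sumr -big_split /=; apply: eq_bigr => s _; ring.
rewrite e2 /evenp big_nat1 e1 !(exprD q (n * _)) (exprS q (2 * n).+1) (exprS q (2 * n)).
move: (q ^+ (n * _)) (q ^+ (2 * n)) (psi_sum _) => b a c; ring.
Qed.

End GaussFinite.

(** * Congruence of polynomials modulo a power of the variable *)

Section Congruence.
Variable F : fieldType.
Implicit Types p q : {poly F}.

Definition eqX M p q := 'X^M %| p - q.

Lemma eqX_refl M p : eqX M p p. Proof. by rewrite /eqX subrr dvdp0. Qed.

Lemma eqX_sym M p q : eqX M p q -> eqX M q p.
Proof. by rewrite /eqX -(opprB p) dvdpNr. Qed.

Lemma eqX_trans M q p r : eqX M p q -> eqX M q r -> eqX M p r.
Proof. by move=> h1 h2; have := dvdp_add h1 h2; rewrite /eqX addrA subrK. Qed.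

Lemma eqXD M p p' q q' : eqX M p p' -> eqX M q q' -> eqX M (p + q) (p' + q').
Proof. by move=> h1 h2; have := dvdp_add h1 h2; rewrite /eqX opprD addrACA. Qed.

Lemma eqXM M p p' q q' : eqX M p p' -> eqX M q q' -> eqX M (p * q) (p' * q').
Proof.
move=> h1 h2; rewrite /eqX.
have -> : p * q - p' * q' = (p - p') * q + p' * (q - q') by ring.
by apply: dvdp_add; [apply: dvdp_mulr | apply: dvdp_mull].
Qed.

Lemma eqXN M p q : eqX M p q -> eqX M (- p) (- q).
Proof. by rewrite /eqX -opprD dvdpNr. Qed.

Lemma eqXX M p q n : eqX M p q -> eqX M (p ^+ n) (q ^+ n).
Proof.
move=> h; elim: n => [|n IHn]; first exact: eqX_refl.
by rewrite !exprS; apply: eqXM.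
Qed.

Lemma eqX_low M n p q : (M <= n)%N -> eqX M (p + 'X^n * q) p.
Proof. by move=> le; rewrite /eqX addrAC subrr add0r dvdp_mulr // dvdp_exp2l. Qed.

Lemma eqX_weaken M n p q : (M <= n)%N -> eqX n p q -> eqX M p q.
Proof. by move=> le; apply: dvdp_trans; rewrite dvdp_exp2l. Qed.

(** A polynomial with nonzero constant term is a unit modulo ['X^M]. *)
Lemma eqX_cancel M p q r : r.[0] != 0 -> eqX M (r * p) (r * q) -> eqX M p q.
Proof.
move=> r0; rewrite /eqX -mulrBr Gauss_dvdpr //.
by rewrite coprimep_expl // coprimep_sym coprimepX.
Qed.

Lemma eqX_coef M p q i : eqX M p q -> (i < M)%N -> p`_i = q`_i.
Proof.
case/dvdpP => r /(canRL (subrK _)) -> lt_iM.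
by rewrite coefD coefMXn lt_iM add0r.
Qed.

Lemma eqX_eqcoef M p q : (forall i, (i < M)%N -> p`_i = q`_i) -> eqX M p q.
Proof.
move=> h; apply/dvdpP; exists (drop_poly M (p - q)).
rewrite -{1}[p - q](poly_take_drop M) [take_poly _ _](_ : _ = 0) ?add0r //.
by apply/polyP => i; rewrite coef_take_poly coef0; case: ltnP => // /h;
   rewrite coefB => ->; rewrite subrr.
Qed.

(** The operator p |-> 'X * p^`() multiplies the coefficient of index i by i,
    so unlike the plain derivative it loses no order of precision. *)
Lemma eqX_xderiv M p q : eqX M p q -> eqX M ('X * p^`()) ('X * q^`()).
Proof.
move=> h; apply: eqX_eqcoef => -[|i] lt_iM; rewrite !coefXM //= !coef_deriv.
by rewrite (eqX_coef h).
Qed.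

Lemma eqX_prod1 M (I : Type) (s : seq I) (P : pred I) (f : I -> {poly F}) :
  (forall i, P i -> eqX M (f i) 1) -> eqX M (\prod_(i <- s | P i) f i) 1.
Proof.
move=> h; elim/big_ind: _ => [|x y hx hy|//]; first exact: eqX_refl.
by rewrite -[1]mulr1; apply: eqXM.
Qed.

End Congruence.

(** * Product and sum expressions of psi *)

Section Euler.
Variable F : fieldType.
Local Notation D := (@oddp {poly F} 'X).
Local Notation E := (@evenp {poly F} 'X).

Lemma oddp_horner0 n : (D n).[0] != 0.
Proof.
rewrite /oddp horner_prod big1 ?oner_eq0 // => j _.
by rewrite !hornerE expr0n subr0.
Qed.

Lemma big_pairs (T : Type) (idx : T) (op : Monoid.law idx) (f : nat -> T) n :
  \big[op/idx]_(0 <= j < n) op (f (2 * j)%N) (f (2 * j).+1) =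
  \big[op/idx]_(0 <= m < 2 * n) f m.
Proof.
elim: n => [|n IHn]; first by rewrite !big_nil.
have -> : (2 * n.+1 = (2 * n).+2)%N by lia.
by rewrite !big_nat_recr //= IHn Monoid.mulmA.
Qed.

Lemma eqX_1sub M m : (M <= m)%N -> eqX M (1 - 'X^m : {poly F}) 1.
Proof. by move=> le; rewrite -['X^m]mulr1 -mulrN; apply: eqX_low. Qed.

Lemma evenp_tail n m : (n <= m)%N -> eqX (2 * n).+2 (E n m) 1.
Proof.
move=> le_nm; rewrite /evenp big_nat; apply: eqX_prod1 => j /andP[le_nj _].
by apply: eqX_1sub; lia.
Qed.

Lemma evenp_cat n m : (n <= m)%N -> E 0 m = E 0 n * E n m.
Proof. by move=> le; rewrite /evenp -big_cat_nat. Qed.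

Definition psi_factor (m : nat) : {poly F} := (1 - 'X^(2 * m)) * (1 + 'X^m).
Definition psi_prod n : {poly F} := \prod_(1 <= m < n.+1) psi_factor m.

Lemma psi_prod_horner0 n : (psi_prod n).[0] != 0.
Proof.
rewrite /psi_prod horner_prod big_nat big1 ?oner_eq0 // => j /andP[j0 _].
by case: j j0 => // j _; rewrite !hornerE !expr0n /= subr0 addr0 mulr1.
Qed.

(** Euler's argument: the factors 1 - X^m for m <= 2n are those of [D n] and
    of [E 0 n], and (1 - X^m) (1 + X^m) = 1 - X^(2m), so the product P of the
    1 + X^m satisfies P * D n * E 0 n = E 0 (2 * n), i.e. P * D n is congruent
    to 1. *)
Lemma psi_prod_odd n : eqX (2 * n).+1 (psi_prod (2 * n) * D n) (E 0 n).
Proof.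
pose P := \prod_(0 <= m < 2 * n) (1 + 'X^(m.+1) : {poly F}).
have lePP : (n <= 2 * n)%N by lia.
have PE : P * D n * E 0 n = E 0 (2 * n).
  rewrite -mulrA -big_split /= (big_pairs _ (fun m => 1 - 'X^(m.+1) : {poly F})).
  rewrite -big_split /= /evenp; apply: eq_bigr => m _.
  have -> : ((2 * m).+2 = m.+1 * 2)%N by lia.
  by rewrite exprM; ring.
have -> : psi_prod (2 * n) * D n = E 0 n * E n (2 * n) ^+ 2.
  rewrite /psi_prod big_add1 /= big_split /= -/P.
  have -> : \prod_(0 <= i < 2 * n) (1 - 'X^(2 * i.+1)) = E 0 (2 * n).
    by apply: eq_bigr => i _; congr (1 - 'X^_); lia.
  rewrite [X in X * P](evenp_cat lePP).
  have -> : E 0 n * E n (2 * n) * P * D n = E n (2 * n) * (P * D n * E 0 n) by ring.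
  by rewrite PE (evenp_cat lePP); ring.
rewrite -{2}[E 0 n]mulr1 -(expr1n _ 2); apply: eqXM (eqX_refl _ _) _.
by apply/eqXX/(eqX_weaken _ (evenp_tail lePP)).
Qed.

(** Once multiplied by [D n], both sides are congruent to [E 0 n]: every term with
    s > 0 in Shanks's identity is divisible by X^(2n+1). *)
Lemma gauss_psi n : (0 < n)%N -> eqX (2 * n).+1 (psi_sum 'X (2 * n)) (psi_prod (2 * n)).
Proof.
move=> n0; apply: (eqX_cancel (oddp_horner0 n)); rewrite ![D n * _]mulrC.
apply: eqX_trans (eqX_sym (psi_prod_odd n)).
rewrite shanks_identity; case: n n0 => // n _.
rewrite big_nat_recl // mul0n expr0 mulr1 {1}/oddp big_nil mul1r.
rewrite /eqX addrAC subrr add0r; apply: (big_ind (fun p => _ %| p)) => [|x y|i _].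
- exact: dvdp0.
- exact: dvdp_add.
by apply/dvdp_mull/dvdp_exp2l; rewrite leq_pmull.
Qed.

(** * The logarithmic derivative of psi *)

(** The truncation of X^m / (1 - X^m) below degree [M], for m > 0. *)
Definition mult_series M m : {poly F} := \poly_(i < M) ((0 < i) && (m %| i))%N%:R.

Lemma mult_seriesE M m : (0 < m)%N ->
  eqX M ((1 - 'X^m) * mult_series M m) 'X^m.
Proof.
move=> m0; apply: eqX_eqcoef => i lt_iM.
rewrite mulrBl mul1r coefB coefXnM !coef_poly coefXn lt_iM.
have [lt_im|le_mi] := ltnP i m.
  have [->|i0] := posnP i; first by rewrite subr0 eq_sym eqn0Ngt m0.
  by rewrite gtnNdvd // subr0 ltn_eqF.
rewrite (leq_ltn_trans (leq_subr _ _) lt_iM) subn_gt0.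
have -> : (m %| i)%N = (m %| i - m)%N by rewrite -{1}(subnK le_mi) dvdn_addl.
rewrite (leq_trans m0 le_mi) /=.
case: ltngtP le_mi => // [lt_mi|->] _; first by rewrite subrr.
by rewrite subnn dvdn0 subr0.
Qed.

(** Leibniz's rule: the factor 1 - X^e has logarithmic derivative
    - e X^e / (1 - X^e). *)
Lemma xderiv_prod M n (e : nat -> nat) : (forall j, (0 < e j)%N) ->
  let P := \prod_(0 <= j < n) (1 - 'X^(e j)) in
  eqX M ('X * P^`()) (- P * \sum_(0 <= j < n) (e j)%:R * mult_series M (e j)).
Proof.
move=> e0 /=; elim: n => [|n IHn].
  by rewrite !big_nil derivC !mulr0; exact: eqX_refl.
rewrite !big_nat_recr //=; set P := \prod_(0 <= j < n) _ in IHn *.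
set S := \sum_(0 <= j < n) _ in IHn *.
set f := 1 - 'X^(e n); set G := mult_series M (e n).
have df : 'X * f^`() = - ((e n)%:R * 'X^(e n)).
  by rewrite /f derivB derivC derivXn sub0r mulrN mulrnAr -exprS prednK // mulr_natl.
have -> : 'X * (P * f)^`() = 'X * P^`() * f + - P * (e n)%:R * 'X^(e n).
  by rewrite derivM mulrDr mulrA mulrCA df; move: (_%:R : {poly F}) => c; ring.
have -> : - (P * f) * (S + (e n)%:R * G) = - P * S * f + - P * (e n)%:R * (f * G).
  by move: (_%:R : {poly F}) => c; ring.
apply: eqXD; first exact: eqXM (eqX_refl _ _).
exact: eqXM (eqX_refl _ _) (eqX_sym (mult_seriesE _ (e0 n))).
Qed.

(** The sum of (-1)^(d-1) d X^d / (1 - X^d) over 1 <= d <= n: odd d come from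
    the denominator of psi, even d from its numerator. *)
Definition log_xderiv M n : {poly F} :=
  \sum_(0 <= m < n) (-1) ^+ m * (m.+1%:R * mult_series M m.+1).

(** Differentiate the congruence T * D n = E 0 n and replace the derivatives
    of [D n] and [E 0 n] by their products with logarithmic derivatives; then
    [D n] can be cancelled. *)
Lemma xderiv_psi M n : (0 < n)%N -> (M <= (2 * n).+1)%N ->
  eqX M ('X * (psi_sum 'X (2 * n))^`())
        (psi_sum 'X (2 * n) * log_xderiv M (2 * n)).
Proof.
move=> n0 leM; set T := psi_sum _ _; set L := log_xderiv _ _.
have hD := xderiv_prod M n (fun j => ltn0Sn (2 * j)).
have hE := xderiv_prod M n (fun j => ltn0Sn (2 * j).+1).
move: hD hE => /=; rewrite -/(D n) -/(E 0 n).
set A := \sum_(_ <= _ < _) _; set B := \sum_(_ <= _ < _) _ => hD hE.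
have LE : L = A - B.
  rewrite /L /log_xderiv -big_pairs /= /A /B -sumrB; apply: eq_bigr => j _.
  by rewrite exprS exprM sqrrN !expr1n mulr1 mul1r mulN1r.
have TD : eqX M (T * D n) (E 0 n).
  apply: eqX_trans (eqX_weaken leM (psi_prod_odd n)).
  exact: eqXM (eqX_weaken leM (gauss_psi n0)) (eqX_refl _ _).
apply: (eqX_cancel (oddp_horner0 n)).
have -> : D n * ('X * T^`()) = 'X * (T * D n)^`() + - T * ('X * (D n)^`()).
  by rewrite derivM; ring.
have -> : D n * (T * L) = - (T * D n) * B + - T * (- D n * A) by rewrite LE; ring.
apply: eqXD; last exact: eqXM (eqX_refl _ _) hD.
apply: eqX_trans (eqX_xderiv TD) _; apply: eqX_trans hE _.
exact: eqXM (eqXN (eqX_sym TD)) (eqX_refl _ _).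
Qed.

(** X^d / (1 - X^d) has coefficient 1 at the positive multiples of d, and the
    divisors of i are all at most n. *)
Lemma log_xderiv_coef M n i : (0 < i < M)%N -> (i <= n)%N ->
  (log_xderiv M n)`_i = \sum_(d <- divisors i) (-1) ^+ (d - 1) * d%:R.
Proof.
case/andP=> i0 ltiM le_in; rewrite coef_sum.
transitivity (\sum_(1 <= d < n.+1 | (d %| i)%N) (-1) ^+ (d - 1) * d%:R : F).
  rewrite big_add1 [RHS]big_mkcond /=; apply: eq_bigr => m _.
  rewrite subn1 /= -signr_odd.
  have -> : ((-1) ^+ odd m * (m.+1%:R * mult_series M m.+1))`_i =
            (-1) ^+ odd m * (m.+1%:R * (mult_series M m.+1)`_i).
    by rewrite mulr_natl mulr_natl -coefMn; case: (odd m);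
       rewrite ?mulN1r ?mul1r ?coefN.
  by rewrite coef_poly ltiM i0 signr_odd /=; case: (_ %| _)%N;
     rewrite ?mulr1 ?mulr0.
rewrite -big_filter; apply: perm_big; apply: uniq_perm.
- by rewrite filter_uniq // iota_uniq.
- exact: divisors_uniq.
move=> d; rewrite mem_filter mem_index_iota -dvdn_divisors //.
case: (boolP (d %| i)%N) => //= hd; rewrite (dvdn_gt0 i0 hd) ltnS /=.
exact: leq_trans (dvdn_leq i0 hd) le_in.
Qed.

End Euler.

(** * Reduction modulo 3 *)

Lemma triangular_double k : ('C(k.+1, 2) * 2 = k.+1 * k)%N.
Proof. by rewrite bin2 muln2 halfK oddM /= andNb subn0. Qed.

(** Among the triangular numbers of index 3k, 3k+1 and 3k+2, the first and the
    third vanish modulo 3, whereas the second is 1 plus 9 times the triangular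
    number of index k.  With exactly three times as many terms on the left
    the equality is exact, and it is proved three terms at a time. *)
Lemma xderiv_psi_sum_char3 (F : fieldType) (n : nat) : 3 \in [pchar F] ->
  'X * (psi_sum 'X (3 * n))^`() = 'X * psi_sum 'X n ^+ 9 :> {poly F}.
Proof.
move=> p3; elim: n => [|n IHn].
  by rewrite muln0 /psi_sum big_nil derivC mulr0 expr0n mulr0.
have p3P : 3 \in [pchar {poly F}] by rewrite pchar_poly.
have -> : (3 * n.+1 = (3 * n).+3)%N by lia.
have nat9 : [pchar {poly F}].-nat 9 by rewrite (eq_pnat _ (pcharf_eq p3P)).
rewrite !psi_sumS exprDn_pchar // -exprM !derivD !derivXn !mulrDr IHn -!addrA.
congr (_ + _).
have c3 (p : {poly F}) k : p *+ (3 * k) = 0.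
  by rewrite mulrnA -(mulr_natr p 3) (pcharf0 p3P) mulr0 mul0rn.
have xd k : 'X * ('X^(k.-1) *+ k) = 'X^k *+ k :> {poly F}.
  by case: k => [|k]; rewrite ?mulr0n ?mulr0 //= mulrnAr -exprS.
rewrite !xd.
have t := triangular_double n; have t0 := triangular_double (3 * n).
have t1 := triangular_double (3 * n).+1.
have t2 := triangular_double (3 * n).+2.
have -> : 'C((3 * n).+1, 2) = (3 * (3 * 'C(n.+1, 2) - n))%N by lia.
have -> : 'C((3 * n).+3, 2) = (3 * (3 * 'C(n.+1, 2) + n.+1))%N by lia.
have -> : 'C((3 * n).+2, 2) = ('C(n.+1, 2) * 9).+1 by lia.
have -> : ('C(n.+1, 2) * 9 = 3 * (3 * 'C(n.+1, 2)))%N by lia.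
by rewrite mulrS !c3 addr0 add0r addr0 exprS.
Qed.

(** The triangular number of index k is at least k, so the terms of index
    at least M vanish modulo X^M. *)
Lemma psi_sum_stable (F : fieldType) M n m : (M <= n <= m)%N ->
  eqX M (psi_sum ('X : {poly F}) m) (psi_sum 'X n).
Proof.
case/andP=> le_Mn; elim: m => [|m IHm]; first by case: n le_Mn => // _ _; exact: eqX_refl.
rewrite leq_eqVlt => /predU1P[->|]; first exact: eqX_refl.
move=> /[dup] lt_nm /IHm; apply: eqX_trans; rewrite psi_sumS -['X^_]mulr1.
by apply: eqX_low; have := triangular_double m; nia.
Qed.

Lemma map_nu_prod (F : fieldType) n :
  map_poly (intr : int -> F) (\prod_(1 <= m < n.+1) nu_factor m) = psi_prod F n ^+ 8.
Proof.
rewrite rmorph_prod /psi_prod -prodrXl; apply: eq_bigr => m _.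
by rewrite exprMn rmorphM !rmorphXn rmorphB rmorphD rmorph1 !rmorphXn /= map_polyX.
Qed.

(** Cubing is the identity on F_3. *)
Lemma sigma3_tilde_F3 n :
  (sigma3_tilde n)%:~R = \sum_(d <- divisors n) (-1) ^+ (d - 1) * d%:R :> 'F_3.
Proof.
rewrite /sigma3_tilde rmorph_sum; apply: eq_bigr => d _.
rewrite rmorphM !rmorphXn rmorphN1 /=; congr (_ * _).
by have := expf_card (d%:R : 'F_3); rewrite card_Fp.
Qed.

Theorem theorem6p2 (nu : nat -> int) (nuP : is_nu nu) (n : nat) (n_gt0 : (0 < n)%N) :
  (nu (n - 1)%N = sigma3_tilde n %[mod 3])%Z.
Proof.
have p3 : 3 \in [pchar 'F_3] by apply: pchar_Fp.
have [N0 hN0] := nuP (n - 1)%N.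
(* The factor 3 matches the number of terms in [xderiv_psi_sum_char3], the
   factor 2 the one in [gauss_psi]; K makes the partial product of nu stable
   and all the precisions at least n + 1. *)
pose K := (N0 + n)%N.
pose T := psi_sum ('X : {poly 'F_3}) (2 * (3 * K)).
pose Psi := psi_prod 'F_3 (2 * (3 * K)).
have K0 : (0 < K)%N by rewrite /K; lia.
have TPsi : eqX n.+1 T Psi by apply: eqX_weaken (gauss_psi _ _); rewrite /K; lia.
have main : eqX n.+1 ('X * Psi ^+ 8) (log_xderiv 'F_3 n.+1 (2 * (3 * K))).
  (* After multiplication by Psi both sides become X times the derivative of T. *)
  apply: (eqX_cancel (psi_prod_horner0 'F_3 (2 * (3 * K)))); rewrite -/Psi.
  apply: eqX_trans (eqXM TPsi (eqX_refl _ _)).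
  have le1 : (n.+1 <= (2 * (3 * K)).+1)%N by rewrite /K; lia.
  have K30 : (0 < 3 * K)%N by rewrite muln_gt0.
  apply: eqX_trans (xderiv_psi 'F_3 K30 le1).
  rewrite mulrCA -exprS mulnCA xderiv_psi_sum_char3 //.
  apply: eqXM (eqX_refl _ _) _; apply: eqXX; apply: eqX_trans (eqX_sym TPsi) _.
  apply: psi_sum_stable; rewrite /K; lia.
have co := eqX_coef main (ltnSn n).
rewrite log_xderiv_coef ?n_gt0 ?ltnSn // in co; last by rewrite /K; lia.
apply/eqP; rewrite eqz_mod_dvd (dvdz_pcharf p3) rmorphB subr_eq0; apply/eqP.
rewrite [RHS]sigma3_tilde_F3 -co coefXM gtn_eqF // -subn1.
rewrite -(hN0 (2 * (3 * K))%N); last by rewrite /K; lia.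
by rewrite -coef_map /= map_nu_prod.
Qed.
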